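(* Let $G$ be a connected graph. Then $EC(G)=3$ if and only if $G\in\{C_3,P_4,K_{1,3}\}$ (up to isomorphism), where $P_4$ is the path on four vertices.
   Context: Graphs are finite and simple. Two distinct edges are adjacent if they share an endpoint. A set $D\subseteq E$ is an edge-dominating set of $G=(V,E)$ if every edge in $E\setminus D$ is adjacent to an edge of $D$. Two disjoint sets of edges $E_1,E_2$ form an edge coalition if neither is an edge-dominating set but $E_1\cup E_2$ is. An $ec$-partition of $G$ is a partition $\pi=\{E_1,\ldots,E_k\}$ of $E$ into nonempty sets such that every $E_i$ is either a singleton edge-dominating set, or is not an edge-dominating set but forms an edge coalition with another set $E_j$ of $\pi$. The edge coalition number $EC(G)$ is the maximum order $k$ of an $ec$-partition of $G$. *)

(* Defs.v *)
From mathcomp Require Import all_boot.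

Set Implicit Arguments.
Unset Strict Implicit.
Unset Printing Implicit Defensive.

Record sgraph := SGraph {
  vertex :> finType;
  adj : rel vertex;
  adj_sym : symmetric adj;
  adj_irr : irreflexive adj }.

Arguments adj {s} _ _.

(* An edge is identified with the set of its two endpoints. *)
Definition edges (G : sgraph) : {set {set G}} :=
  [set e | [exists x, exists y, adj x y && (e == [set x; y])]].

(* The graph with no vertex is not considered to be connected. *)
Definition connected_graph (G : sgraph) : Prop :=
  0 < #|G| /\ forall x y : G, connect adj x y.

Definition graph_iso (G H : sgraph) : Prop :=
  exists2 f : G -> H, bijective f & forall x y, adj (f x) (f y) = adj x y.

Section EdgeCoalition.
Variable G : sgraph.
Implicit Types (e f : {set G}) (A B D : {set {set G}}).

Definition edge_adjacent e f : bool := (e != f) && (e :&: f != set0).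

Definition edge_dominating D : bool :=
  (D \subset edges G) &&
  [forall e in edges G :\: D, exists f in D, edge_adjacent e f].

Definition edge_coalition A B : bool :=
  [&& A \subset edges G, B \subset edges G, [disjoint A & B],
      ~~ edge_dominating A, ~~ edge_dominating B
    & edge_dominating (A :|: B)].

(* [partition] already requires the blocks to be nonempty. *)
Definition ec_partition (pi : {set {set {set G}}}) : bool :=
  partition pi (edges G) &&
  [forall A in pi,
     (#|A| == 1) && edge_dominating A
  || ~~ edge_dominating A && [exists B in pi :\ A, edge_coalition A B]].

Definition edge_coalition_number : nat :=
  \max_(pi : {set {set {set G}}} | ec_partition pi) #|pi|.

End EdgeCoalition.

Definition path_rel n : rel 'I_n := [rel i j : 'I_n | (i.+1 == j) || (j.+1 == i)].

Fact path_rel_sym n : symmetric (@path_rel n).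
Proof. by move=> i j; rewrite /path_rel /= orbC. Qed.

Fact path_rel_irr n : irreflexive (@path_rel n).
Proof. by move=> i; rewrite /path_rel /= orbb gtn_eqF. Qed.

Definition path_graph n : sgraph := SGraph (@path_rel_sym n) (@path_rel_irr n).

(* Only meant for 3 <= n; the conjunct i != j just removes the loop that
   would otherwise appear when n = 1. *)
Definition cycle_rel n : rel 'I_n :=
  [rel i j : 'I_n | (i != j) && ((ordS i == j) || (ordS j == i))].

Fact cycle_rel_sym n : symmetric (@cycle_rel n).
Proof. by move=> i j; rewrite /cycle_rel /= eq_sym orbC. Qed.

Fact cycle_rel_irr n : irreflexive (@cycle_rel n).
Proof. by move=> i; rewrite /cycle_rel /= eqxx. Qed.

Definition cycle_graph n : sgraph :=
  SGraph (@cycle_rel_sym n) (@cycle_rel_irr n).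

Definition bipartite_rel m n : rel ('I_m + 'I_n) :=
  [rel u v : 'I_m + 'I_n | match u, v with
             | inl _, inr _ | inr _, inl _ => true
             | _, _ => false
             end].

Fact bipartite_rel_sym m n : symmetric (@bipartite_rel m n).
Proof. by case=> ? []. Qed.

Fact bipartite_rel_irr m n : irreflexive (@bipartite_rel m n).
Proof. by case. Qed.

Definition complete_bipartite m n : sgraph :=
  SGraph (@bipartite_rel_sym m n) (@bipartite_rel_irr m n).

(* Main.v *)
Require Import Defs.
From mathcomp Require Import all_boot.

(** For a connected graph [G] with at least one edge, [EC(G)] is the number of
    edges as soon as some edge [e] dominates alone (lemma [ec_number_full]): the
    partition of the edges into singletons is then an ec-partition.  If no edge
    dominates alone, [EC(G) >= 4] (lemma [ec_number_ge4]).  Indeed, as in any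
    graph without isolated vertices, a minimal dominating set and its complement
    are two disjoint dominating sets of edges, and any dominating set can be
    partitioned into at least two non-dominating blocks, each of which has a
    coalition partner among the others (lemma [coalition_split]).

    As [EC(G)] never exceeds the number of edges, [EC(G) = 3] holds exactly when
    [G] has three edges (lemma [ec_number_eq3]).  One of the three edges then
    dominates alone, and attaching the other two to it in all possible ways
    yields the triangle, the path and the claw (lemma [three_edges_iso]). *)

Set Implicit Arguments.
Unset Strict Implicit.
Unset Printing Implicit Defensive.

(** * Finite sets and partitions *)

Lemma eq_set2 (T : finType) (x y u v : T) : x != y ->
  ([set x; y] == [set u; v]) = (x == u) && (y == v) || (x == v) && (y == u).
Proof.
move=> nxy; apply/eqP/idP=> [eqxy|].
  have:= set21 x y; have:= set22 x y; rewrite eqxy !inE.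
  move=> /orP[]/eqP Ey /orP[]/eqP Ex; move: nxy; rewrite Ex Ey ?eqxx //= orbT //.
by case/orP=> /andP[/eqP-> /eqP->] //; rewrite setUC.
Qed.

Lemma imset_set2 (aT rT : finType) (f : aT -> rT) x y :
  [set f z | z in [set x; y]] = [set f x; f y].
Proof. by rewrite imsetU !imset_set1. Qed.

Lemma card_leq_size (T : finType) (s : seq T) :
  (forall x, x \in s) -> #|T| <= size s.
Proof.
move=> all_s; apply: leq_trans (card_size s).
by apply/subset_leq_card/subsetP=> x _.
Qed.

Section Partitions.
Variable T : finType.
Implicit Types (D S : {set T}) (P Q : {set {set T}}).

Lemma disjoint_partitions P Q D S :
  [disjoint D & S] -> partition P D -> partition Q S -> [disjoint P & Q].
Proof.
move=> disDS partP partQ; rewrite -setI_eq0; apply: contraT => /set0Pn[A /setIP[PA QA]].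
suff /eqP A0 : A == set0 by rewrite A0 (partition0 partP) in PA.
rewrite -subset0 -(disjoint_setI0 disDS) subsetI.
by rewrite -{1}(cover_partition partP) -(cover_partition partQ) !bigcup_sup.
Qed.

Lemma partitionU P Q D S :
    [disjoint D & S] -> partition P D -> partition Q S ->
  partition (P :|: Q) (D :|: S).
Proof.
move=> disDS /and3P[/eqP cP tP P0] /and3P[/eqP cQ tQ Q0].
rewrite /partition inE negb_or P0 Q0 andbT /= trivIsetU // ?cP ?cQ // andbT.
by rewrite /cover bigcup_setU -/(cover P) -/(cover Q) cP cQ eqxx.
Qed.

Lemma card_partition_leq P D : partition P D -> #|P| <= #|D|.
Proof.
move=> partP; rewrite (card_partition partP) -sum1_card leq_sum // => A PA.
by rewrite card_gt0; apply: contraTneq PA => ->; case/and3P: partP.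
Qed.

Lemma singletons_partition D : partition [set [set x] | x in D] D.
Proof.
apply/and3P; split.
- apply/eqP/setP=> x; rewrite /cover; apply/bigcupP/idP=> [[_ /imsetP[y Dy ->]]|Dx].
    by move/set1P->.
  by exists [set x]; rewrite ?set11 ?imset_f.
- apply/trivIsetP=> _ _ /imsetP[x _ ->] /imsetP[y _ ->].
  by rewrite (inj_eq set1_inj) disjoints1 inE.
by apply/imsetP=> -[x _ /setP/(_ x)]; rewrite !inE eqxx.
Qed.

End Partitions.

(** * Splitting a dominating set into coalition partners *)

Section Splitting.
Variables (T : finType) (dom : pred {set T}).
Implicit Types (A B D S : {set T}) (P Q : {set {set T}}).

(** Partners are sought inside [P] itself, so that such families can be put
    together; for a notion of domination without dominating singletons this is
    the condition on the blocks of an ec-partition. *)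
Definition coalition_blocks P : Prop :=
  forall A, A \in P -> ~~ dom A /\ exists2 B, B \in P :\ A & dom (A :|: B).

(** Let [A] be a maximal non-dominating subset of [S]: adding to [A] any element
    of the rest [S :\: A] makes it dominating, so that [A] is not empty because
    singletons do not dominate.  If the rest does not dominate, [A] and the rest
    are partners.  If it does, split it by induction; its blocks have partners
    among themselves, and [A] is a partner of any of them because a block
    contains an element of the rest. *)
Lemma coalition_split S :
    (forall A B, A \subset B -> dom A -> dom B) ->
    (forall x, x \in S -> ~~ dom [set x]) -> dom S ->
  exists2 P, partition P S & coalition_blocks P.
Proof.
move=> domS; have [n] := ubnP #|S|.
elim: n S => // n IHn S ltSn small dS.
have [S0|[x Sx]] := set_0Vmem S.
  exists set0; last by move=> A; rewrite inE.
  by rewrite S0 partition_set0.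
have nd0 : ~~ dom set0 by apply: contra (small x Sx); apply: domS; apply: sub0set.
have p0 : (set0 \subset S) && ~~ dom set0 by rewrite sub0set.
have [A /maxsetP[/andP[sAS ndA] maxA] _] :=
  @maxset_exists _ [pred A : {set T} | (A \subset S) && ~~ dom A] set0 p0.
have domA1 y : y \in S :\: A -> dom (y |: A).
  case/setDP=> Sy nAy; apply: contraT => ndyA; case/negP: nAy.
  by rewrite -(maxA (y |: A)) ?setU11 ?subsetUr //= ndyA subUset sub1set Sy sAS.
have A_gt0 : A != set0.
  apply: contraNneq (small x Sx) => A0.
  by rewrite -[ [set x] ]setU0 -A0 domA1 // A0 setD0.
have disjA : [disjoint A & S :\: A].
  by rewrite -setI_eq0 setIDA setDIl setDv set0I.
have eqS : A :|: (S :\: A) = S by rewrite setDE setUIr setUCr setIT; apply/setUidPr.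
have /set0Pn[y By] : S :\: A != set0.
  by apply: contraNneq ndA => B0; rewrite -(setU0 A) -B0 eqS.
have [dB|ndB] := boolP (dom (S :\: A)); last first.
  have partB : partition [set S :\: A] (S :\: A).
    apply/and3P; split; rewrite ?cover1 ?trivIset1 // inE eq_sym.
    by apply/set0Pn; exists y.
  exists (A |: [set S :\: A]).
    by rewrite -[X in partition _ X]eqS partitionU1.
  have neq : A != S :\: A.
    by apply: contraNneq A_gt0 => eqA; rewrite -setI_eq0 -eqA setIid in disjA.
  move=> C; rewrite !inE => /orP[]/eqP->; split=> //.
    by exists (S :\: A); rewrite ?eqS // !inE eq_sym neq eqxx orbT.
  by exists A; rewrite 1?(setUC _ A) ?eqS // !inE neq eqxx.
have ltB : #|S :\: A| < n.
  rewrite -ltnS; apply: leq_trans ltSn; rewrite ltnS; apply: proper_card.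
  rewrite properEneq subsetDl andbT; apply: contraNneq A_gt0 => eqB.
  by rewrite -setI_eq0 eqB (setIidPl sAS) in disjA.
have smallB z : z \in S :\: A -> ~~ dom [set z].
  by case/setDP=> Sz _; apply: small.
have [P partP coalP] := IHn _ ltB smallB dB.
have nPA : A \notin P.
  apply: contra A_gt0 => PA; have: A \subset S :\: A.
    by rewrite -(cover_partition partP) bigcup_sup.
  by move/setIidPl=> <-; rewrite setI_eq0.
exists (A |: P); first by rewrite -[X in partition _ X]eqS partitionU1.
move=> C /setU1P[->|PC].
  split=> //; rewrite -(cover_partition partP) in By.
  case/bigcupP: (By) => B PB By'; exists B; first by rewrite setU1K.
  apply: domS (domA1 y _); first by rewrite setUC setUS // sub1set.
  by rewrite -(cover_partition partP).
have [ndC [B /setD1P[nBC PB] dCB]] := coalP C PC.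
by split=> //; exists B => //; rewrite !inE nBC PB orbT.
Qed.

Lemma coalition_blocks_gt1 P S :
  partition P S -> S != set0 -> coalition_blocks P -> 1 < #|P|.
Proof.
move=> partP /set0Pn[x]; rewrite -(cover_partition partP) => /bigcupP[A PA _].
case/(_ A PA)=> _ [B PAB _]; rewrite (cardsD1 A) PA ltnS card_gt0.
by apply/set0Pn; exists B.
Qed.

Lemma coalition_blocksU P Q :
  coalition_blocks P -> coalition_blocks Q -> coalition_blocks (P :|: Q).
Proof.
move=> cP cQ A; rewrite inE => /orP[/cP|/cQ] [ndA [B /setD1P[nBA PB] dAB]].
  by split=> //; exists B; rewrite // !inE nBA PB.
by split=> //; exists B; rewrite // !inE nBA PB orbT.
Qed.

End Splitting.

(** * Edge domination *)

Section EdgeDomination.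
Variable G : sgraph.
Implicit Types (e f g : {set G}) (A B D : {set {set G}})
  (pi : {set {set {set G}}}).

Lemma edgesP e :
  reflect (exists x y : G, adj x y /\ e = [set x; y]) (e \in edges G).
Proof.
rewrite inE; apply: (iffP existsP) => [[x /existsP[y /andP[xy /eqP->]]]|].
  by exists x, y.
by case=> x [y [xy ->]]; exists x; apply/existsP; exists y; rewrite xy eqxx.
Qed.

Lemma adj_neq (x y : G) : adj x y -> x != y.
Proof. by apply: contraTneq => ->; rewrite adj_irr. Qed.

Lemma mem_edges (x y : G) : ([set x; y] \in edges G) = adj x y.
Proof.
apply/edgesP/idP=> [[u [v [uv]]]|xy]; last by exists x, y.
move/eqP; rewrite eq_sym eq_set2 ?adj_neq //.
by case/orP=> /andP[/eqP<- /eqP<-] //; rewrite adj_sym.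
Qed.

Lemma edge_meets_self e : e \in edges G -> e :&: e != set0.
Proof.
case/edgesP=> x [y [_ ->]]; rewrite setIid.
by apply/set0Pn; exists x; apply: set21.
Qed.

(** Since an edge meets itself, requiring that every edge (and not only the
    edges outside [D]) meets [D] expresses edge domination; unlike
    [edge_dominating], this is upward closed among all sets of vertex sets. *)
Definition meets_all D : bool :=
  [forall e in edges G, [exists f in D, e :&: f != set0]].

Lemma meets_allP D :
  reflect (forall e, e \in edges G -> exists2 f, f \in D & e :&: f != set0)
          (meets_all D).
Proof.
by apply: (iffP forall_inP) => H e /H => [/exists_inP|/exists_inP].
Qed.

Lemma edge_dominatingE D :
  edge_dominating D = (D \subset edges G) && meets_all D.
Proof.
rewrite /edge_dominating; case: (boolP (D \subset _)) => //= sD.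
apply/forall_inP/meets_allP => [domD e Ee|metD e /setDP[Ee nDe]].
  have [De|nDe] := boolP (e \in D); first by exists e; rewrite ?edge_meets_self.
  have /exists_inP[f Df /andP[_ ef]] := domD e (introT setDP (conj Ee nDe)).
  by exists f.
have [f Df ef] := metD e Ee; apply/exists_inP; exists f => //.
by rewrite /edge_adjacent ef andbT; apply: contraNneq nDe => ->.
Qed.

Lemma meets_allS A B : A \subset B -> meets_all A -> meets_all B.
Proof.
move=> sAB /meets_allP mA; apply/meets_allP=> e /mA[f Af ef].
by exists f; rewrite ?(subsetP sAB).
Qed.

Lemma ec_number_leq : edge_coalition_number G <= #|edges G|.
Proof.
by apply/bigmax_leqP=> pi /andP[partpi _]; apply: card_partition_leq partpi.
Qed.

Lemma ec_partition_of_coalition_blocks pi :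
  partition pi (edges G) -> coalition_blocks meets_all pi -> ec_partition pi.
Proof.
move=> partpi coalpi; rewrite /ec_partition partpi /=; apply/forall_inP=> A piA.
have [ndA [B /setD1P[nBA piB] dAB]] := coalpi A piA.
have [ndB _] := coalpi B piB.
have sE C : C \in pi -> C \subset edges G.
  by move=> piC; rewrite -(cover_partition partpi) bigcup_sup.
have disAB : [disjoint A & B].
  by case/and3P: partpi => _ /trivIsetP tI _; rewrite tI // eq_sym.
apply/orP; right; rewrite edge_dominatingE sE ?ndA //=.
apply/exists_inP; exists B; first by rewrite !inE nBA.
by rewrite /edge_coalition !edge_dominatingE subUset !sE // disAB dAB ndA ndB.
Qed.

(** Ore's argument.  If no edge outside [D] meets [e], then [e] is in [D] and so
    are all edges that meet it; every one of these is still met after removing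
    [e] from [D], by itself or, for [e], by its neighbor, and the edges that do
    not meet [e] are not affected.  This contradicts minimality. *)
Lemma minimal_dominating_setC D :
    (forall e, e \in edges G ->
       exists2 f, f \in edges G & (f != e) && (e :&: f != set0)) ->
    minset meets_all D ->
  meets_all (edges G :\: D).
Proof.
move=> nbr /minsetP[/meets_allP dD minD]; apply/meets_allP=> e Ee.
have [De|nDe] := boolP (e \in D); last first.
  by exists e; [rewrite inE nDe | apply: edge_meets_self].
apply/exists_inP; apply: contraT; rewrite negb_exists_in => /forall_inP inD.
have Dmeet f : f \in edges G -> e :&: f != set0 -> f \in D.
  by move=> Ef ef; apply: contraLR ef => nDf; apply: inD; rewrite inE nDf.
suff /minD/(_ (subD1set D e)) eqD : meets_all (D :\ e).
  by move: De; rewrite -eqD !inE eqxx.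
have [e' Ee' /andP[ne'e ee']] := nbr e Ee.
apply/meets_allP=> x Ex; have [xe|nxe] := eqVneq x e.
  by exists e'; rewrite ?xe // !inE ne'e Dmeet.
have [f Df xf] := dD x Ex; have [fe|nfe] := eqVneq f e.
  exists x; last exact: edge_meets_self.
  by rewrite !inE nxe Dmeet // setIC -fe.
by exists f; rewrite // !inE nfe.
Qed.

(** Otherwise the endpoints of [e] form a connected component, which an edge
    not meeting [e] leaves. *)
Lemma connected_edge_neighbor e :
    connected_graph G -> e \in edges G -> ~~ meets_all [set e] ->
  exists2 f, f \in edges G & (f != e) && (e :&: f != set0).
Proof.
case=> _ conn Ee; rewrite negb_forall_in => /exists_inP[g Eg].
rewrite negb_exists_in => /forall_inP/(_ e (set11 e)); rewrite negbK => /eqP ge0.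
apply/exists_inP; apply: contraT; rewrite negb_exists_in => /forall_inP alone.
have cle : closed adj (mem e).
  apply: intro_closed => [|x y xy ex]; first exact/sym_connect_sym/adj_sym.
  have:= alone [set x; y]; rewrite mem_edges => /(_ xy).
  rewrite negb_and negbK => /orP[/eqP<-|]; first exact: set22.
  by case/negP; apply/set0Pn; exists x; rewrite !inE ex eqxx.
have /set0Pn[x /setIP[ex _]] := edge_meets_self Ee.
have /set0Pn[z /setIP[gz _]] := edge_meets_self Eg.
have:= closed_connect cle (conn x z); rewrite ![_ \in mem _]/= ex => /esym ez.
by have:= in_set0 z; rewrite -ge0 inE gz ez.
Qed.

(** Both a minimal dominating set and its complement dominate; each of them
    splits into at least two blocks with coalition partners. *)
Lemma ec_number_ge4 :
    connected_graph G -> edges G != set0 ->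
    (forall e, e \in edges G -> ~~ meets_all [set e]) ->
  3 < edge_coalition_number G.
Proof.
move=> conn E0 nfull.
have domE : meets_all (edges G).
  by apply/meets_allP=> e Ee; exists e; rewrite ?edge_meets_self.
have [D minD sDE] := minset_exists domE.
have dD := minsetp minD.
have dC : meets_all (edges G :\: D).
  apply: minimal_dominating_setC minD => e Ee.
  by apply: connected_edge_neighbor; rewrite ?nfull.
have split A : A \subset edges G -> meets_all A ->
    exists2 P, partition P A & coalition_blocks meets_all P.
  move=> /subsetP sA; apply: coalition_split; first exact: meets_allS.
  by move=> x /sA/nfull.
have ne0 A : meets_all A -> A != set0.
  case/set0Pn: E0 => e Ee /meets_allP/(_ e Ee)[f Af _].
  by apply/set0Pn; exists f.
have [P partP coalP] := split D sDE dD.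
have [Q partQ coalQ] := split _ (subsetDl _ _) dC.
have disDC : [disjoint D & edges G :\: D].
  by rewrite -setI_eq0 setIDA setDIl setDv set0I.
have partPQ : partition (P :|: Q) (edges G).
  rewrite -(setID (edges G) D) (setIidPr sDE).
  exact: partitionU.
have ecPQ := ec_partition_of_coalition_blocks partPQ (coalition_blocksU coalP coalQ).
apply: leq_trans (leq_bigmax_cond _ ecPQ).
rewrite cardsU disjoint_setI0 ?(disjoint_partitions disDC) // cards0 subn0.
apply: (@leq_add 2 2).
  exact: coalition_blocks_gt1 partP (ne0 _ dD) coalP.
exact: coalition_blocks_gt1 partQ (ne0 _ dC) coalQ.
Qed.

(** The singletons form an ec-partition: if [x] does not dominate, some [y] is
    disjoint from [x].  Both meet [e] in distinct vertices, hence together they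
    contain both endpoints of [e], which every edge meets. *)
Lemma ec_number_full e :
    e \in edges G -> meets_all [set e] ->
  edge_coalition_number G = #|edges G|.
Proof.
move=> Ee /meets_allP full; have {}full g : g \in edges G -> g :&: e != set0.
  by case/full=> f /set1P->.
apply/eqP; rewrite eqn_leq ec_number_leq /=.
rewrite -(card_imset (edges G) (@set1_inj _)); apply: leq_bigmax_cond.
rewrite /ec_partition singletons_partition; apply/forall_inP=> _ /imsetP[x Ex ->].
rewrite cards1 eqxx /= !edge_dominatingE sub1set Ex /=.
case: (boolP (meets_all [set x])) => //=.
rewrite negb_forall_in => /exists_inP[y Ey].
rewrite negb_exists_in => /forall_inP/(_ x (set11 x)); rewrite negbK => /eqP yx0.
have nxy : x != y.
  by apply: contraTneq (edge_meets_self Ex) => eqxy; rewrite {1}eqxy yx0 eqxx.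
have no_meet z t : z \in edges G -> z :&: t = set0 -> ~~ meets_all [set t].
  move=> Ez zt0; apply/negP=> /meets_allP/(_ z Ez)[f /set1P->].
  by rewrite zt0 eqxx.
apply/exists_inP; exists [set y].
  by rewrite !inE (inj_eq set1_inj) eq_sym nxy imset_f.
rewrite /edge_coalition !edge_dominatingE subUset !sub1set Ex Ey /=.
rewrite disjoints1 inE nxy (no_meet y) // (no_meet x) 1?setIC //=.
apply/meets_allP=> g Eg.
have /set0Pn[a /setIP[xa ea]] := full x Ex.
have /set0Pn[b /setIP[yb eb]] := full y Ey.
have /set0Pn[c /setIP[gc ec]] := full g Eg.
have nab : a != b.
  by apply: contraFneq (in_set0 a) => eqab; rewrite -yx0 inE xa eqab yb.
have eqe : e = [set a; b].
  have [u [v [uv euv]]] := edgesP _ Ee.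
  apply/esym/eqP; rewrite eqEcard subUset !sub1set ea eb cards2 nab.
  by rewrite euv cards2; case: (u != v).
move: ec; rewrite eqe => /set2P[] cab.
  by exists x; rewrite ?set21 //; apply/set0Pn; exists c; rewrite inE gc cab.
by exists y; rewrite ?set22 //; apply/set0Pn; exists c; rewrite inE gc cab.
Qed.

(** With a dominating edge both numbers agree; without one, both are at least 4
    or, if there is no edge, zero. *)
Lemma ec_number_eq3 :
  connected_graph G -> edge_coalition_number G = 3 <-> #|edges G| = 3.
Proof.
move=> conn; have [fulls|] := boolP [exists e in edges G, meets_all [set e]].
  by have /exists_inP[e Ee /(ec_number_full Ee)->] := fulls.
rewrite negb_exists_in => /forall_inP nfull.
have le_ec := ec_number_leq.
have [E0|E0] := eqVneq (edges G) set0.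
  by move: le_ec; rewrite E0 cards0 leqn0 => /eqP->.
have gt3 := ec_number_ge4 conn E0 nfull.
by split=> eq3; move: gt3; rewrite ltnNge -?eq3 ?le_ec // eq3.
Qed.

End EdgeDomination.

(** * Graphs with three edges *)

Section Isomorphisms.
Implicit Types G H : sgraph.

(** Comparing edge sets reduces an isomorphism with a graph on three edges to an
    identity between two explicit sets of three pairs. *)
Lemma graph_iso_of_edges G H (g : H -> G) :
  bijective g -> edges G = [set g @: (e : {set H}) | e in edges H] ->
  graph_iso G H.
Proof.
case=> f gK fK eqE; exists f; first by exists g.
move=> x y; rewrite -!mem_edges eqE -{2}(fK x) -{2}(fK y) -(imset_set2 g).
exact: esym (mem_imset _ _ (imset_inj (can_inj gK))).
Qed.

Lemma card_edges_iso G H : graph_iso G H -> #|edges G| = #|edges H|.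
Proof.
case=> f [g fK gK] adjf.
rewrite -(card_imset (edges G) (imset_inj (can_inj fK))); congr #|pred_of_set _|.
apply/setP=> e; apply/imsetP/idP=> [[_ /edgesP[x [y [xy ->]]] ->]|].
  by rewrite imset_set2 mem_edges adjf.
case/edgesP=> x [y [xy ->]]; exists [set g x; g y].
  by rewrite mem_edges -adjf !gK.
by rewrite imset_set2 !gK.
Qed.

Lemma edges3E H (a b c d p q : H) :
    (forall x y : H, adj x y =
       [|| (x == a) && (y == b) || (x == b) && (y == a),
           (x == c) && (y == d) || (x == d) && (y == c)
         | (x == p) && (y == q) || (x == q) && (y == p)]) ->
  edges H = [set [set a; b]; [set c; d]; [set p; q]].
Proof.
move=> adjE; apply/setP=> e; apply/edgesP/idP=> [[x [y [xy ->]]]|].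
  by rewrite !inE !eq_set2 ?adj_neq // -orbA -adjE.
rewrite !inE -orbA => /or3P[]/eqP->.
- by exists a, b; rewrite adjE !eqxx.
- by exists c, d; rewrite adjE !eqxx /= orbT.
- by exists p, q; rewrite adjE !eqxx /= !orbT.
Qed.

Lemma edges_cycle3 : edges (cycle_graph 3) =
  [set [set @Ordinal 3 0 isT; @Ordinal 3 1 isT];
       [set @Ordinal 3 1 isT; @Ordinal 3 2 isT];
       [set @Ordinal 3 2 isT; @Ordinal 3 0 isT]].
Proof. by apply: edges3E => -[[|[|[|//]]] i] [[|[|[|//]]] j]. Qed.

Lemma edges_path4 : edges (path_graph 4) =
  [set [set @Ordinal 4 0 isT; @Ordinal 4 1 isT];
       [set @Ordinal 4 1 isT; @Ordinal 4 2 isT];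
       [set @Ordinal 4 2 isT; @Ordinal 4 3 isT]].
Proof. by apply: edges3E => -[[|[|[|[|//]]]] i] [[|[|[|[|//]]]] j]. Qed.

Lemma edges_claw : edges (complete_bipartite 1 3) =
  [set [set inl ord0; inr (@Ordinal 3 0 isT)];
       [set inl ord0; inr (@Ordinal 3 1 isT)];
       [set inl ord0; inr (@Ordinal 3 2 isT)]].
Proof.
by apply: edges3E => -[[[|//] i]|[[|[|[|//]]] i]] [[[|//] j]|[[|[|[|//]]] j]].
Qed.

Lemma card_edges_cycle3 : #|edges (cycle_graph 3)| = 3.
Proof. by rewrite edges_cycle3 -setUA !cardsU1 cards1 !inE !eq_set2. Qed.

Lemma card_edges_path4 : #|edges (path_graph 4)| = 3.
Proof. by rewrite edges_path4 -setUA !cardsU1 cards1 !inE !eq_set2. Qed.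

Lemma card_edges_claw : #|edges (complete_bipartite 1 3)| = 3.
Proof. by rewrite edges_claw -setUA !cardsU1 cards1 !inE !eq_set2. Qed.

Lemma iso_cycle3 G (x y z : G) :
    uniq [:: x; y; z] -> (forall t, t \in [:: x; y; z]) ->
    edges G = [set [set x; y]; [set y; z]; [set z; x]] ->
  graph_iso G (cycle_graph 3).
Proof.
move=> Us alls eqE.
apply: (@graph_iso_of_edges G (cycle_graph 3)
  (fun i : 'I_3 => nth x [:: x; y; z] i)).
  apply: inj_card_bij; last by rewrite card_ord; apply: card_leq_size alls.
  by move=> i j /eqP; rewrite nth_uniq // => /eqP/val_inj.
by rewrite edges_cycle3 !imsetU !imset_set1 !imset_set2.
Qed.

Lemma iso_path4 G (x y z t : G) :
    uniq [:: x; y; z; t] -> (forall s, s \in [:: x; y; z; t]) ->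
    edges G = [set [set x; y]; [set y; z]; [set z; t]] ->
  graph_iso G (path_graph 4).
Proof.
move=> Us alls eqE.
apply: (@graph_iso_of_edges G (path_graph 4)
  (fun i : 'I_4 => nth x [:: x; y; z; t] i)).
  apply: inj_card_bij; last by rewrite card_ord; apply: card_leq_size alls.
  by move=> i j /eqP; rewrite nth_uniq // => /eqP/val_inj.
by rewrite edges_path4 !imsetU !imset_set1 !imset_set2.
Qed.

Lemma iso_claw G (x y z t : G) :
    uniq [:: x; y; z; t] -> (forall s, s \in [:: x; y; z; t]) ->
    edges G = [set [set x; y]; [set x; z]; [set x; t]] ->
  graph_iso G (complete_bipartite 1 3).
Proof.
move=> Us alls eqE; have /andP[nxs Us'] := Us.
pose g (i : 'I_1 + 'I_3) := if i is inr j then nth x [:: y; z; t] j else x.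
apply: (@graph_iso_of_edges G (complete_bipartite 1 3) g).
  apply: inj_card_bij; last by rewrite card_sum !card_ord; apply: card_leq_size alls.
  move=> [i|i] [j|j] /= /eqP eqg; first by rewrite !ord1.
  - by move: nxs; rewrite (eqP eqg) mem_nth.
  - by move: nxs; rewrite -(eqP eqg) mem_nth.
  by move: eqg; rewrite nth_uniq // => /eqP/val_inj->.
by rewrite edges_claw !imsetU !imset_set1 !imset_set2.
Qed.

End Isomorphisms.

Section ThreeEdges.
Variable G : sgraph.

Lemma connected_vertex_covered (x : G) :
    connected_graph G -> edges G != set0 ->
  exists2 e, e \in edges G & x \in e.
Proof.
case=> _ conn /set0Pn[e /edgesP[u [v [uv _]]]].
have [y nyx] : exists y, y != x.
  have [->|nux] := eqVneq x u; first by exists v; rewrite eq_sym adj_neq.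
  by exists u; rewrite eq_sym.
have /connectP[[|z p] /= xp ylast] := conn x y.
  by rewrite ylast eqxx in nyx.
by case/andP: xp => xz _; exists [set x; z]; rewrite ?mem_edges ?set21.
Qed.

Lemma edge_at (u v : G) (f : {set G}) :
    f \in edges G -> f != [set u; v] -> f :&: [set u; v] != set0 ->
  exists a w, [/\ a \in [:: u; v], w \notin [:: u; v] & f = [set a; w]].
Proof.
case/edgesP=> x [y [xy ->]]; have nxy := adj_neq xy.
rewrite eq_set2 // => nuv /set0Pn[z]; rewrite !inE.
case: (boolP (x \in [:: u; v])) => [xuv|nxuv].
  move=> _; exists x, y; split=> //; apply: contra nuv.
  move: xuv nxy; rewrite !inE => /orP[]/eqP-> nxy /orP[]/eqP yE; move: nxy;
    by rewrite yE ?eqxx ?orbT.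
case/andP=> /orP[]/eqP-> zuv; first by rewrite !inE zuv in nxuv.
by exists y, x; rewrite !inE setUC; split=> //; rewrite !inE in nxuv.
Qed.

(** Both pendant edges at [u] give the claw; one at each endpoint gives the
    triangle [w u v] if their far ends agree, and the path [w u v z] if not. *)
Lemma three_edges_shape (u v w b z : G) :
    u != v -> w \notin [:: u; v] -> z \notin [:: u; v] -> b \in [:: u; v] ->
    [set u; w] != [set b; z] -> (forall s, s \in [:: u; v; w; z]) ->
    edges G = [set [set u; v]; [set u; w]; [set b; z]] ->
  [\/ graph_iso G (cycle_graph 3), graph_iso G (path_graph 4)
    | graph_iso G (complete_bipartite 1 3)].
Proof.
rewrite !inE !negb_or => nuv /andP[nwu nwv] /andP[nzu nzv] buv nfg alls eqE.
have [buv' |buv'] := orP buv; rewrite (eqP buv') in nfg eqE.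
  have nwz : w != z by apply: contraNneq nfg => ->.
  apply: Or33; apply: iso_claw alls eqE.
  rewrite /= !inE !negb_or nuv nwz ![_ == w]eq_sym ![_ == z]eq_sym.
  by rewrite nwu nwv nzu nzv.
have [wz|nwz] := eqVneq w z.
  apply: Or31; apply: (@iso_cycle3 _ w u v).
  - by rewrite /= !inE negb_or nwu nwv nuv.
  - by move=> s; move: (alls s); rewrite -wz !inE; do 3!case: (s == _).
  by rewrite eqE -wz (setUC [set w]) [RHS]setUAC [in RHS]setUC setUA.
apply: Or32; apply: (@iso_path4 _ w u v z).
- by rewrite /= !inE !negb_or nwu nwv nwz nuv ![_ == z]eq_sym nzu nzv.
- by move=> s; move: (alls s); rewrite !inE; do 4!case: (s == _).
by rewrite eqE (setUC [set w]) (setUC [set [set u; v]]).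
Qed.

(** Some edge dominates alone, since otherwise there would be an ec-partition of
    the three edges with at least four blocks.  The other two edges then hang on
    its endpoints, at the same one or at different ones. *)
Lemma three_edges_iso : connected_graph G -> #|edges G| = 3 ->
  [\/ graph_iso G (cycle_graph 3), graph_iso G (path_graph 4)
    | graph_iso G (complete_bipartite 1 3)].
Proof.
move=> conn card3; have E0 : edges G != set0 by rewrite -card_gt0 card3.
have [e Ee /meets_allP full] : exists2 e, e \in edges G & meets_all [set e].
  apply/exists_inP; apply: contraT; rewrite negb_exists_in => /forall_inP nfull.
  suff: 3 < #|edges G| by rewrite card3.
  exact: leq_trans (ec_number_ge4 conn E0 nfull) (ec_number_leq G).
have [f [g [nfg eqE]]] : exists f g, f != g /\ edges G :\ e = [set f; g].
  by apply/cards2P; move: card3; rewrite (cardsD1 e) Ee add1n => -[->].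
have [u [v [uv eq_e]]] := edgesP _ Ee; subst e.
have at_uv h : h \in [set f; g] ->
    exists a w, [/\ a \in [:: u; v], w \notin [:: u; v] & h = [set a; w]].
  rewrite -eqE => /setD1P[nh Eh]; apply: edge_at => //.
  by have [_ /set1P->] := full h Eh.
have {}eqE : edges G = [set [set u; v]; f; g] by rewrite -setUA -eqE setD1K.
have [a [w [auv wuv eq_f]]] := at_uv f (set21 f g).
have [b [z [buv zuv eq_g]]] := at_uv g (set22 f g).
have nuv := adj_neq uv.
have alls s : s \in [:: u; v; w; z].
  have [h Eh hs] := connected_vertex_covered s conn E0.
  move: Eh hs auv buv; rewrite eqE eq_f eq_g !inE -orbA.
  case/or3P=> /eqP->; rewrite !inE => /orP[]/eqP Es /orP[]/eqP Ea /orP[]/eqP Eb;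
    by rewrite Es ?Ea ?Eb ?eqxx ?orbT.
rewrite eq_f eq_g in eqE nfg.
rewrite in_cons mem_seq1 in auv; case/orP: auv => /eqP eq_a;
  rewrite eq_a in nfg eqE.
  exact: three_edges_shape nuv wuv zuv buv nfg alls eqE.
(* The first pendant edge is at [v]: exchange the roles of [u] and [v]. *)
have swap s : (s \in [:: u; v]) = (s \in [:: v; u]) by rewrite !inE orbC.
have nvu : v != u by rewrite eq_sym.
rewrite swap in wuv; rewrite swap in zuv; rewrite swap in buv.
apply: three_edges_shape nvu wuv zuv buv nfg _ _.
  by move=> s; move: (alls s); rewrite !inE; do 2!case: (s == _).
by rewrite eqE (setUC [set u] [set v]).
Qed.

End ThreeEdges.

Theorem theorem5p5 (G : sgraph) (hG : connected_graph G) :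
  edge_coalition_number G = 3 <->
  [\/ graph_iso G (cycle_graph 3), graph_iso G (path_graph 4)
    | graph_iso G (complete_bipartite 1 3)].
Proof.
apply: iff_trans (ec_number_eq3 hG) _; split; first exact: three_edges_iso.
case=> /card_edges_iso->;
  [exact: card_edges_cycle3 | exact: card_edges_path4 | exact: card_edges_claw].
Qed.
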